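(* Let $r:\mathbb R_+\to(0,\infty)$ be a positive smooth Lipschitz function of $t$, let $z=(z_1,z_2)^{\mathsf T}$ with constants $z_1,z_2\in\mathbb R$, and let $V$, $a=(0,\sqrt{r(t)})^{\mathsf T}$ and $\mathfrak R(t,x)$ be as in the context. Then $$\mathfrak R-\tfrac12\partial_t(aa^{\mathsf T})=\begin{pmatrix}z_1z_2&\frac12\big[r(t)+r(t)z_1z_2+z_2^2-z_1^2\nabla^2_{xx}V(x)\big]\\ \frac12\big[r(t)+r(t)z_1z_2+z_2^2-z_1^2\nabla^2_{xx}V(x)\big]&r(t)^2+r(t)z_2^2-z_1z_2\nabla^2_{xx}V(x)-\frac12\partial_tr(t)\end{pmatrix}.$$ Assume that $0<\underline\lambda\le\partial^2_{xx}V\le\overline\lambda$, and that there exists a constant $z_2\in\Big(0,\frac{r(t)+\sqrt{r(t)^2+4r(t)}}2\Big)$, for all $t\ge t_0$, such that $\underline\lambda,\overline\lambda$ satisfy the following conditions (with $r=r(t)$): $$-\overline\lambda^2+\big[2(r(1+z_2)-z_2^2)\big]\underline\lambda-\big[(1-z_2)r+z_2^2\big]^2-2z_2\partial_tr>0,\qquad r^2+rz_2^2-\overline\lambda z_2-\tfrac12\partial_tr>0.$$ Then there exists a function $\lambda(t)>0$, for $t>t_0$, such that $$\mathfrak R-\tfrac12\partial_t(aa^{\mathsf T})\succeq\lambda(t)\,(aa^{\mathsf T}+zz^{\mathsf T}).$$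
   Context: The setting is the underdamped Langevin dynamics $dx_t=v_t\,dt$, $dv_t=(-r(t)v_t-\nabla_xV(x_t))\,dt+\sqrt{2r(t)}\,dB_t$ for $(x_t,v_t)\in\mathbb R^2$, where $B_t$ is a standard one-dimensional Brownian motion and $V\in C^2(\mathbb R)$ is a Lipschitz potential function with $\int_{\mathbb R}e^{-V(x)}dx<\infty$. Its diffusion matrix is $a=(0,\sqrt{r(t)})^{\mathsf T}$. For a constant vector $z=(z_1,z_2)^{\mathsf T}\in\mathbb R^2$, the time-dependent Hessian matrix function is $\mathfrak R=\mathfrak R_a+\mathfrak R_z+\mathfrak R_{\gamma_a}+\mathfrak R_{\gamma_z}$ with $$\mathfrak R_a=\begin{pmatrix}0&0\\0&r(t)^2\end{pmatrix},\quad\mathfrak R_z=r(t)\begin{pmatrix}0&\frac{z_1z_2}2\\\frac{z_1z_2}2&z_2^2\end{pmatrix},\quad\mathfrak R_{\gamma_a}=r(t)\begin{pmatrix}0&\frac12\\\frac12&0\end{pmatrix},$$ $$\mathfrak R_{\gamma_z}=\begin{pmatrix}z_1z_2&\frac12(z_2^2-z_1^2\nabla^2_{xx}V)\\\frac12(z_2^2-z_1^2\nabla^2_{xx}V)&-z_1z_2\nabla^2_{xx}V\end{pmatrix}.$$ Here $\nabla^2_{xx}V=\partial^2_{xx}V$ is the second derivative of $V$, and $\succeq$ is the order of symmetric matrices.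
   Formalization: The second part is stated for z_1 = 1, as the displayed conditions presuppose (it fails e.g. for z_1 = 0), and V is only required to be Lipschitz or to have a Lipschitz derivative, since a Lipschitz V cannot have second derivative bounded below by a positive constant. *)

(* Defs.v *)
From HB Require Import structures.
From mathcomp Require Import all_boot all_order all_algebra.
From mathcomp Require Import all_classical all_reals all_analysis.
Set Implicit Arguments.
Unset Strict Implicit.
Unset Printing Implicit Defensive.
Import Order.TTheory GRing.Theory Num.Theory.
Import numFieldNormedType.Exports.
Local Open Scope classical_set_scope.
Local Open Scope ring_scope.

Definition col2 (R : realType) (u v : R) : 'cV[R]_2 :=
  \col_(i < 2) if i == 0 then u else v.

Definition mx22 (R : realType) (m00 m01 m10 m11 : R) : 'M[R]_2 :=
  \matrix_(i < 2, j < 2)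
    if i == 0 then (if j == 0 then m00 else m01)
    else (if j == 0 then m10 else m11).

Definition psd (R : realType) (n : nat) (A : 'M[R]_n) : Prop :=
  A^T = A /\ forall u : 'cV[R]_n, 0 <= (u^T *m A *m u) 0 0.

Definition loewner_le (R : realType) (n : nat) (A B : 'M[R]_n) : Prop :=
  [/\ A^T = A, B^T = B & psd (B - A)].

(* Smoothness on a set that need not be open, such as [0, +oo[: the total
   function f stands for a smooth extension of its restriction to D, so it is
   smooth on an open neighbourhood of each point of D. At the end point 0 of
   [0, +oo[ the two-sided derivative of f is then the one-sided one. *)
Definition smooth_on (R : realType) (D : set R) (f : R -> R) : Prop :=
  forall t, D t -> \forall s \near t, forall n : nat,
    derivable (derive1n n f) s 1.

Definition C2 (R : realType) (V : R -> R) : Prop :=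
  [/\ forall x, derivable V x 1, forall x, derivable (derive1 V) x 1
    & continuous (derive1n 2 V)].

(* A "Lipschitz potential" is understood to have either a Lipschitz V or a
   Lipschitz force V', which is what makes the drift -r v - V'(x) Lipschitz.
   The second alternative matters: a globally Lipschitz V has a bounded
   derivative and hence never satisfies 0 < lo <= V'' on the whole line, whereas
   0 < lo <= V'' <= hi is compatible with a Lipschitz V'. *)
Definition lipschitz_potential (R : realType) (V : R -> R) : Prop :=
  lipschitz V \/ lipschitz (derive1 V).

Definition potential (R : realType) (V : R -> R) : Prop :=
  [/\ C2 V, lipschitz_potential V &
    (\int[lebesgue_measure]_(x in [set: R]) (expR (- V x))%:E < +oo)%E].

Section Hessian.
Context {R : realType}.
Variables (r V : R -> R) (z1 z2 : R).

(* The column a, so that sqrt(2 r) dB = sqrt 2 a dB. *)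
Definition diffusion (t : R) : 'cV[R]_2 := col2 0 (Num.sqrt (r t)).

Definition diffusion_sq (t : R) : 'M[R]_2 := diffusion t *m (diffusion t)^T.

Definition hess_a (t : R) : 'M[R]_2 := mx22 0 0 0 (r t ^+ 2).

Definition hess_z (t : R) : 'M[R]_2 :=
  r t *: mx22 0 (z1 * z2 / 2) (z1 * z2 / 2) (z2 ^+ 2).

Definition hess_gamma_a (t : R) : 'M[R]_2 :=
  r t *: mx22 0 (1 / 2) (1 / 2) 0.

Definition hess_gamma_z (x : R) : 'M[R]_2 :=
  mx22 (z1 * z2) (1 / 2 * (z2 ^+ 2 - z1 ^+ 2 * derive1n 2 V x))
       (1 / 2 * (z2 ^+ 2 - z1 ^+ 2 * derive1n 2 V x))
       (- (z1 * z2 * derive1n 2 V x)).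

Definition hess (t x : R) : 'M[R]_2 :=
  hess_a t + hess_z t + hess_gamma_a t + hess_gamma_z x.

End Hessian.

(* Main.v *)
Require Import Defs.
From HB Require Import structures.
From mathcomp Require Import all_boot all_order all_algebra.
From mathcomp Require Import all_classical all_reals all_analysis.
From mathcomp Require Import ring lra.
Import Order.TTheory GRing.Theory Num.Theory.
Import numFieldNormedType.Exports.
Local Open Scope classical_set_scope.
Local Open Scope ring_scope.

(** Near each [t >= 0] the function [r] is positive, so [a a^T] is [r] times a
    constant matrix, its derivative is [r'] times that matrix
    ([derive1_diffusion_sq]), and the formula for the corrected Hessian is
    entrywise algebra.

    For the inequality take [z_1 = 1] and put [w = V''(x)]. The corrected Hessian
    is a symmetric matrix [A] of order 2, and both hypotheses bear on it through
    the extreme values of [w]: the first is a lower bound, strictly positive, of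
    [4 det A] ([det_hess_ge], where the upper bound on [z_2] makes the
    coefficient of [w] positive), and the second says that the lower right entry
    is positive even for the largest [w], so that the trace is positive. Hence
    [A] is positive definite uniformly in [x]: with [c(t)] the first hypothesis
    and [T(t)] the value of the trace for the least [w], the eigenvalues of [A]
    are at least [c(t) / (4 T(t))]. Since [a a^T + z z^T] has trace
    [1 + z_2 ^ 2 + r], the choice [lambda = c / (4 T (1 + z_2 ^ 2 + r))] works
    ([loewner_le_det_tr]), and it depends on [t] only. *)


(** The square root disappears, so the smoothness of [r] passes to [a a^T]. The
    sign hypothesis makes [Num.sqrt] a true square root. *)
Lemma diffusion_sqE (R : realType) (r : R -> R) (t : R) (rt_ge0 : 0 <= r t) :
  diffusion_sq r t = r t *: mx22 0 0 0 1.
Proof.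
rewrite /diffusion_sq /diffusion; apply/matrixP => i j.
rewrite !mxE big_ord1 !mxE.
case: (i == 0); case: (j == 0); rewrite ?mul0r ?mulr0 // mulr1.
by rewrite -expr2 sqr_sqrtr.
Qed.

Lemma derive1_scale (R : realType) (W : normedModType R) (f : R -> R) (w : W)
    (t : R) (f_der : derivable f t 1) :
  derive1 (fun s => f s *: w) t = derive1 f t *: w.
Proof.
rewrite !derive1E /derive; apply: cvg_lim; first exact: norm_hausdorff.
rewrite [X in X @ _ --> _](_ : _ =
    fun h => (h^-1 *: (f (h *: 1 + t) - f t)) *: w).
  by apply: cvgZr_tmp; exact: f_der.
by apply/funext => h; rewrite -scalerBl scalerA.
Qed.

(** [diffusion_sq r] agrees with [r] times a constant matrix only where [r] is
    nonnegative. Positivity at [t] and continuity give this on a neighbourhood,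
    which is all that a derivative sees; in particular it settles [t = 0], where
    nothing is known about the sign of [r] to the left. *)
Lemma derive1_diffusion_sq (R : realType) (r : R -> R) (t : R)
    (r_der : derivable r t 1) (rt_gt0 : 0 < r t) :
  derive1 (diffusion_sq r) t = derive1 r t *: mx22 0 0 0 1.
Proof.
rewrite -derive1_scale // !derive1E; apply: near_eq_derive.
have r_cont : {for t, continuous r}.
  by apply: differentiable_continuous; apply/derivable1_diffP.
near=> s; apply: diffusion_sqE; apply: ltW; near: s.
exact: (cvgr_gt _ r_cont).
Unshelve. all: by end_near. Qed.

Lemma hess_sub_half_derive (R : realType) (r V : R -> R) (z1 z2 t x : R)
    (r_der : derivable r t 1) (rt_gt0 : 0 < r t) :
  hess r V z1 z2 t x - (1 / 2) *: derive1 (diffusion_sq r) t =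
  mx22 (z1 * z2)
    (1 / 2 * (r t + r t * z1 * z2 + z2 ^+ 2 - z1 ^+ 2 * derive1n 2 V x))
    (1 / 2 * (r t + r t * z1 * z2 + z2 ^+ 2 - z1 ^+ 2 * derive1n 2 V x))
    (r t ^+ 2 + r t * z2 ^+ 2 - z1 * z2 * derive1n 2 V x - 1 / 2 * derive1 r t).
Proof.
rewrite derive1_diffusion_sq // /hess /hess_a /hess_z /hess_gamma_a /hess_gamma_z.
move: (derive1n 2 V x) (derive1 r t) => w r'.
by apply/matrixP => i j; rewrite !mxE; case: (i == 0); case: (j == 0); field.
Qed.

Lemma mx22_sym (R : realType) (p q s : R) : (mx22 p q q s)^T = mx22 p q q s.
Proof. by apply/matrixP => i j; rewrite !mxE; case: (i == 0); case: (j == 0). Qed.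

Lemma mx22_quadratic (R : realType) (p q s : R) (u : 'cV[R]_2) :
  (u^T *m mx22 p q q s *m u) 0 0 =
  p * u 0 0 ^+ 2 + 2 * q * u 0 0 * u 1 0 + s * u 1 0 ^+ 2.
Proof.
rewrite mxE !big_ord_recl big_ord0 !mxE !big_ord_recl !big_ord0 !mxE /=.
have -> : lift ord0 ord0 = 1 :> 'I_2 by apply/val_inj.
by rewrite -[ord0]/(0 : 'I_2); ring.
Qed.

(** For a symmetric matrix [A] of order 2, Cayley-Hamilton reads
    [tr A * A = A ^ 2 + det A * 1], and [A ^ 2] is positive semidefinite, its
    form being the squared norm of [A u]. This replaces the bound
    [det A / tr A] of the least eigenvalue without mentioning eigenvalues. *)
Lemma mx22_form_ge (R : realDomainType) (p q s x y : R) :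
  (p * s - q ^+ 2) * (x ^+ 2 + y ^+ 2) <=
  (p + s) * (p * x ^+ 2 + 2 * q * x * y + s * y ^+ 2).
Proof.
rewrite -subr_ge0.
have -> : (p + s) * (p * x ^+ 2 + 2 * q * x * y + s * y ^+ 2) -
    (p * s - q ^+ 2) * (x ^+ 2 + y ^+ 2) =
    (p * x + q * y) ^+ 2 + (q * x + s * y) ^+ 2 by ring.
by rewrite addr_ge0 ?sqr_ge0.
Qed.

(** The left side is the form of [a a^T + z z^T] for [a = (0, sqrt r)] and the
    vector [(1, z)]; the factor on the right is the trace of that matrix, which
    bounds its largest eigenvalue. *)
Lemma rank2_form_le (R : realDomainType) (r z x y : R) (r_ge0 : 0 <= r) :
  (x + z * y) ^+ 2 + r * y ^+ 2 <= (1 + z ^+ 2 + r) * (x ^+ 2 + y ^+ 2).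
Proof.
rewrite -subr_ge0.
have -> : (1 + z ^+ 2 + r) * (x ^+ 2 + y ^+ 2) -
    ((x + z * y) ^+ 2 + r * y ^+ 2) = (z * x - y) ^+ 2 + r * x ^+ 2 by ring.
by rewrite addr_ge0 ?sqr_ge0 // mulr_ge0 ?sqr_ge0.
Qed.

(** If [A] is the larger matrix and [N] the one on the left, then
    [A >= (det A / tr A) * 1] and [N <= tr N * 1]; so [A] dominates any multiple
    of [N] up to [det A / (tr A * tr N)]. Only a lower bound [c] of the
    determinant and an upper bound [T] of the trace enter the constant, which is
    how it is made uniform in a parameter. *)
Lemma loewner_le_det_tr (R : realType) (p q s c T r z : R) (r_ge0 : 0 <= r)
    (c_ge0 : 0 <= c) (c_le_det : c <= p * s - q ^+ 2)
    (tr_gt0 : 0 < p + s) (tr_le : p + s <= T) :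
  loewner_le (c / (T * (1 + z ^+ 2 + r)) *: mx22 1 z z (z ^+ 2 + r))
    (mx22 p q q s).
Proof.
have T_gt0 : 0 < T by exact: lt_le_trans tr_le.
have n_gt0 : 0 < 1 + z ^+ 2 + r by nra.
set lam := c / _.
have lam_ge0 : 0 <= lam by rewrite divr_ge0 // mulr_ge0 ?ltW.
have lamE : T * (lam * (1 + z ^+ 2 + r)) = c.
  by rewrite mulrCA divfK // mulf_neq0 ?gt_eqF.
have lamME : lam *: mx22 1 z z (z ^+ 2 + r) =
    mx22 (lam * 1) (lam * z) (lam * z) (lam * (z ^+ 2 + r)).
  by apply/matrixP => i j; rewrite !mxE; case: (i == 0); case: (j == 0).
have subE : mx22 p q q s - lam *: mx22 1 z z (z ^+ 2 + r) =
    mx22 (p - lam * 1) (q - lam * z) (q - lam * z) (s - lam * (z ^+ 2 + r)).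
  by apply/matrixP => i j; rewrite !mxE; case: (i == 0); case: (j == 0).
split; rewrite ?lamME ?mx22_sym // -lamME subE.
split=> [|u]; first exact: mx22_sym.
rewrite mx22_quadratic; move: (u 0 0) (u 1 0) => x y.
set Q := p * x ^+ 2 + 2 * q * x * y + s * y ^+ 2.
set N := (x + z * y) ^+ 2 + r * y ^+ 2.
set e := x ^+ 2 + y ^+ 2.
have e_ge0 : 0 <= e by rewrite addr_ge0 ?sqr_ge0.
have -> : (p - lam * 1) * x ^+ 2 + 2 * (q - lam * z) * x * y +
    (s - lam * (z ^+ 2 + r)) * y ^+ 2 = Q - lam * N by rewrite /Q /N; ring.
have ce_le : c * e <= (p + s) * Q.
  exact: le_trans (ler_wpM2r e_ge0 c_le_det) (mx22_form_ge _ _ _ _ _ _).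
have Q_ge0 : 0 <= Q.
  by rewrite -(pmulr_rge0 _ tr_gt0); apply: (le_trans _ ce_le); exact: mulr_ge0.
rewrite subr_ge0 -(ler_pM2l T_gt0).
apply: (le_trans _ (le_trans ce_le (ler_wpM2r Q_ge0 tr_le))).
rewrite -lamE -[leRHS]mulrA ler_pM2l // -mulrA ler_wpM2l //.
exact: rank2_form_le.
Qed.

(** The upper bound on [z] is the positive root of [z ^ 2 = r * z + r]. *)
Lemma quadratic_gt0_below_root (R : rcfType) (r z : R) (z_gt0 : 0 < z)
    (z_lt : z < (r + Num.sqrt (r ^+ 2 + 4 * r)) / 2) (r_gt0 : 0 < r) :
  0 < r * (1 + z) - z ^+ 2.
Proof.
set q := Num.sqrt _ in z_lt.
have q_ge0 : 0 <= q by exact: sqrtr_ge0.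
have q_sqr : q ^+ 2 = r ^+ 2 + 4 * r by rewrite sqr_sqrtr; nra.
(* Otherwise [q ^ 2 <= r ^ 2]. *)
have q_gtr : r < q by nra.
nra.
Qed.

(** Four times the determinant is
    [- w ^ 2 + 2 k w - ((1 - z) r + z ^ 2) ^ 2 - 2 z r'] with
    [k = r (1 + z) - z ^ 2]. As [w >= 0] and [k > 0], the first term is least at
    [w = hi] and the second at [w = lo]; bounding them separately gives the
    left side. *)
Lemma det_hess_ge (R : realFieldType) (r r' z lo hi w : R) (lo_ge0 : 0 <= lo)
    (w_lo : lo <= w) (w_hi : w <= hi) (k_gt0 : 0 < r * (1 + z) - z ^+ 2) :
  - hi ^+ 2 + 2 * (r * (1 + z) - z ^+ 2) * lo
    - ((1 - z) * r + z ^+ 2) ^+ 2 - 2 * z * r' <=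
  4 * (z * (r ^+ 2 + r * z ^+ 2 - z * w - 1 / 2 * r')
       - (1 / 2 * (r + r * z + z ^+ 2 - w)) ^+ 2).
Proof.
have -> : 4 * (z * (r ^+ 2 + r * z ^+ 2 - z * w - 1 / 2 * r')
       - (1 / 2 * (r + r * z + z ^+ 2 - w)) ^+ 2) =
    - w ^+ 2 + 2 * (r * (1 + z) - z ^+ 2) * w
    - ((1 - z) * r + z ^+ 2) ^+ 2 - 2 * z * r' by field.
nra.
Qed.

Theorem proposition18 (R : realType) (r V : R -> R)
    (r_gt0 : forall t, 0 <= t -> 0 < r t)
    (r_smooth : smooth_on [set t : R | 0 <= t] r)
    (r_lip : [lipschitz r t | t in [set t : R | 0 <= t]])
    (V_pot : potential V) :
  (forall z1 z2 t x : R, 0 <= t ->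
    hess r V z1 z2 t x - (1 / 2) *: derive1 (diffusion_sq r) t =
    mx22 (z1 * z2)
      (1 / 2 * (r t + r t * z1 * z2 + z2 ^+ 2 - z1 ^+ 2 * derive1n 2 V x))
      (1 / 2 * (r t + r t * z1 * z2 + z2 ^+ 2 - z1 ^+ 2 * derive1n 2 V x))
      (r t ^+ 2 + r t * z2 ^+ 2 - z1 * z2 * derive1n 2 V x - 1 / 2 * derive1 r t))
  /\
  (forall lo hi t0 z2 : R, 0 <= t0 -> 0 < lo ->
    (forall x, lo <= derive1n 2 V x <= hi) ->
    (forall t, t0 <= t ->
      [/\ 0 < z2 < (r t + Num.sqrt (r t ^+ 2 + 4 * r t)) / 2,
          0 < - hi ^+ 2 + 2 * (r t * (1 + z2) - z2 ^+ 2) * lo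
              - ((1 - z2) * r t + z2 ^+ 2) ^+ 2 - 2 * z2 * derive1 r t
        & 0 < r t ^+ 2 + r t * z2 ^+ 2 - hi * z2 - 1 / 2 * derive1 r t]) ->
    exists lambda : R -> R, forall t, t0 < t ->
      0 < lambda t /\
      forall x, loewner_le
        (lambda t *: (diffusion_sq r t + col2 1 z2 *m (col2 1 z2)^T))
        (hess r V 1 z2 t x - (1 / 2) *: derive1 (diffusion_sq r) t)).
Proof.
have r_der t : 0 <= t -> derivable r t 1.
  (* The case [n = 0] of the smoothness hypothesis, at [t] itself. *)
  by move=> t_ge0; exact: (nbhs_singleton (r_smooth t t_ge0) 0%N).
split=> [z1 z2 t x t_ge0|lo hi t0 z2 t0_ge0 lo_gt0 V_bnd cond].
  by apply: hess_sub_half_derive; [exact: r_der | exact: r_gt0].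
pose c t := - hi ^+ 2 + 2 * (r t * (1 + z2) - z2 ^+ 2) * lo
            - ((1 - z2) * r t + z2 ^+ 2) ^+ 2 - 2 * z2 * derive1 r t.
(* The trace decreases in [V''], so its value at [lo] bounds it. *)
pose T t := z2 + (r t ^+ 2 + r t * z2 ^+ 2 - lo * z2 - 1 / 2 * derive1 r t).
exists (fun t => c t / 4 / (T t * (1 + z2 ^+ 2 + r t))) => t t_gt.
have t_ge0 : 0 <= t by exact: le_trans (ltW t_gt).
have rt_gt0 := r_gt0 t t_ge0.
have [/andP[z2_gt0 z2_lt] ct_gt0 d_gt0] := cond t (ltW t_gt).
have k_gt0 := @quadratic_gt0_below_root _ _ _ z2_gt0 z2_lt rt_gt0.
have lo_le_hi : lo <= hi by have /andP[] := V_bnd 0; exact: le_trans.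
have T_gt0 : 0 < T t by rewrite /T; nra.
have n_gt0 : 0 < 1 + z2 ^+ 2 + r t by nra.
rewrite -/(c t) in ct_gt0.
split=> [|x]; first by rewrite !divr_gt0 // mulr_gt0.
have /andP[w_lo w_hi] := V_bnd x.
have det_le := @det_hess_ge _ (r t) (derive1 r t) _ _ _ _ (ltW lo_gt0) w_lo w_hi k_gt0.
rewrite -/(c t) in det_le.
have -> : diffusion_sq r t + col2 1 z2 *m (col2 1 z2)^T =
    mx22 1 z2 z2 (z2 ^+ 2 + r t).
  rewrite diffusion_sqE ?(ltW rt_gt0) //.
  apply/matrixP => i j; rewrite !mxE big_ord1 !mxE.
  by case: (i == 0); case: (j == 0); ring.
rewrite hess_sub_half_derive //; last exact: r_der.
rewrite mul1r mulr1 expr1n [1 * derive1n 2 V x]mul1r.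
apply: loewner_le_det_tr; first exact: ltW.
- by rewrite divr_ge0 // ltW.
- by rewrite ler_pdivrMr // mulrC.
- by nra.
- by rewrite /T; nra.
Qed.
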